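(* The following assertion is false: ''for all real (formal) power series $f(z)=1+\sum_{n=1}^{\infty}a_{n}z^{n}$ and $g(z)=1+\sum_{n=1}^{\infty}b_{n}z^{n}$ with $g(z)=1/f(-z)$, and for every positive integer $r$, the Toeplitz matrix $T[f]$ is totally positive up to order $r$ if and only if the Toeplitz matrix $T[g]$ is totally positive up to order $r$.'' Specifically: (1) for $f(z)=1+4z+3z^{2}+z^{3}$ and $g(z)=1/f(-z)=1/(1-4z+3z^{2}-z^{3})$, the matrix $T[f]$ is totally positive up to order $2$, but $T[g]$ is not totally positive up to order $2$; (2) for $f(z)=1+z+2z^{2}$ and $g(z)=1/f(-z)=1/(1-z+2z^{2})$, the matrix $T[f]$ is totally positive up to order $1$, but $T[g]$ is not totally positive up to order $1$.
   Context: For a power series $f(z)=\sum_{n=0}^{\infty}a_{n}z^{n}$ with real coefficients, the Toeplitz matrix $T[f]$ is the infinite matrix indexed by pairs of integers $(i,j)\in\mathbb{Z}\times\mathbb{Z}$ with entries $T[f]_{ij}=a_{j-i}$ if $j-i\geq 0$ and $T[f]_{ij}=0$ if $j-i<0$. A minor of order $k$ ($k\ge 1$) of $T[f]$ is the determinant of the $k\times k$ submatrix supported on rows $i_1<\cdots<i_k$ and columns $j_1<\cdots<j_k$ (integers). The matrix $T[f]$ is totally positive up to order $r$ when every minor of $T[f]$ of order at most $r$ is nonnegative. *)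

(* Defs.v *)
From HB Require Import structures.
From mathcomp Require Import all_boot all_order all_algebra.
From mathcomp Require Import reals.

Set Implicit Arguments.
Unset Strict Implicit.
Unset Printing Implicit Defensive.

Import Order.TTheory GRing.Theory Num.Theory.
Local Open Scope ring_scope.

(* A formal power series is its sequence of coefficients. *)
Definition fps (R : realType) := nat -> R.

Definition fps_one (R : realType) : fps R := fun n => (n == 0%N)%:R.

Definition fps_mul (R : realType) (f g : fps R) : fps R :=
  fun n => \sum_(k < n.+1) f k * g (n - k)%N.

(* f(-z) *)
Definition fps_subN (R : realType) (f : fps R) : fps R :=
  fun n => (-1) ^+ n * f n.

Definition fps_of_poly (R : realType) (p : {poly R}) : fps R := fun n => p`_n.

(* The coefficients b_0, ..., b_n of 1/f, obtained by solving the equations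
   f_0 b_0 = 1 and \sum_(k <= m) f_k b_(m-k) = 0 for m > 0. *)
Fixpoint fps_inv_seq (R : realType) (f : fps R) (n : nat) : seq R :=
  if n is m.+1 then
    let s := fps_inv_seq f m in
    rcons s (- (f 0%N)^-1 * \sum_(k < m.+1) f k.+1 * s`_(m - k))
  else [:: (f 0%N)^-1].

(* 1/f; meaningful only when f 0 != 0. *)
Definition fps_inv (R : realType) (f : fps R) : fps R :=
  fun n => (fps_inv_seq f n)`_n.

Lemma size_fps_inv_seq (R : realType) (f : fps R) n :
  size (fps_inv_seq f n) = n.+1.
Proof. by elim: n => //= n IH; rewrite size_rcons IH. Qed.

Lemma nth_fps_inv_seq (R : realType) (f : fps R) n i :
  (i <= n)%N -> (fps_inv_seq f n)`_i = fps_inv f i.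
Proof.
elim: n => [|n IH]; first by rewrite leqn0 => /eqP ->.
rewrite leq_eqVlt => /orP[/eqP -> //|]; rewrite ltnS => le_in.
by rewrite /= nth_rcons size_fps_inv_seq ltnS le_in IH.
Qed.

Lemma fps_invS (R : realType) (f : fps R) n :
  fps_inv f n.+1 =
    - (f 0%N)^-1 * \sum_(k < n.+1) f k.+1 * fps_inv f (n - k)%N.
Proof.
rewrite {1}/fps_inv /= nth_rcons size_fps_inv_seq ltnn eqxx.
by congr (_ * _); apply: eq_bigr => k _; rewrite nth_fps_inv_seq ?leq_subr.
Qed.

Lemma fps_mulfV (R : realType) (f : fps R) :
  f 0%N != 0 -> fps_mul f (fps_inv f) =1 fps_one R.
Proof.
move=> f0 [|n]; rewrite /fps_mul big_ord_recl /= subn0.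
  by rewrite big_ord0 addr0 /fps_inv /= divff.
rewrite fps_invS mulrA mulrN divff // mulN1r.
by under [X in _ + X]eq_bigr do rewrite subSS; rewrite addNr.
Qed.

Lemma fps_inv_uniq (R : realType) (f g : fps R) :
  f 0%N != 0 -> fps_mul f g =1 fps_one R -> g =1 fps_inv f.
Proof.
move=> f0 fg n; elim/ltn_ind: n => n IH; apply: (mulfI f0).
have := etrans (fg n) (esym (fps_mulfV f0 n)).
rewrite /fps_mul !big_ord_recl /= !subn0.
rewrite [X in _ + X = _](_ : _ =
  \sum_(i < n) f (bump 0 i) * fps_inv f (n - bump 0 i)%N); first exact: addIr.
by apply: eq_bigr => i _; rewrite IH // /bump /= ltn_subrL (leq_trans _ (ltn_ord i)).
Qed.

Definition toeplitz (R : realType) (f : fps R) (i j : int) : R :=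
  if 0 <= j - i then f `|j - i|%N else 0.

Definition strictly_increasing (k : nat) (i : 'I_k -> int) : Prop :=
  forall u v : 'I_k, (u < v)%N -> i u < i v.

Definition minor (R : realType) (A : int -> int -> R) (k : nat)
    (i j : 'I_k -> int) : R :=
  \det (\matrix_(u < k, v < k) A (i u) (j v)).

Definition totally_positive_upto (R : realType) (r : nat)
    (A : int -> int -> R) : Prop :=
  forall (k : nat) (i j : 'I_k -> int), (1 <= k <= r)%N ->
    strictly_increasing i -> strictly_increasing j -> 0 <= minor A i j.

(* Main.v *)
(** [T[f]] is totally positive up to order 2 iff the coefficients are
    nonnegative and satisfy [f_t f_(t+x+y) <= f_(t+x) f_(t+y)], a finite check
    for a polynomial. With [g = 1/f(-z) = \sum_n b_n z^n], the quadratic example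
    fails because [b_2 = -1], and the cubic one because
    [b_3, b_4, b_5 = 41, 129, 406] and [129^2 - 41 * 406 = -5]. *)

Require Import Defs.
From HB Require Import structures.
From mathcomp Require Import all_boot all_order all_algebra.
From mathcomp Require Import reals.
From mathcomp Require Import zify ring lra.

Set Implicit Arguments.
Unset Strict Implicit.
Unset Printing Implicit Defensive.

Import Order.TTheory GRing.Theory Num.Theory.
Local Open Scope ring_scope.

Section Toeplitz.
Variables (R : realType) (f : fps R).

Lemma toeplitz_nat (i j : int) (n : nat) : j - i = n%:Z -> toeplitz f i j = f n.
Proof. by move=> e; rewrite /toeplitz e. Qed.

Lemma toeplitz_lt (i j : int) : j < i -> toeplitz f i j = 0.
Proof. by move=> ji; rewrite /toeplitz subr_ge0 leNgt ji. Qed.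

Lemma toeplitz_ge0 : (forall n, 0 <= f n) -> forall i j, 0 <= toeplitz f i j.
Proof. by move=> f0 i j; rewrite /toeplitz; case: ifP. Qed.

(** The order-1 minor on row [0] and column [n] is the coefficient [f n] itself. *)
Lemma totally_positive_coef_ge0 r : (0 < r)%N ->
  totally_positive_upto r (toeplitz f) -> forall n, 0 <= f n.
Proof.
move=> r0 tp n.
have incr (c : int) : strictly_increasing (fun _ : 'I_1 => c).
  by move=> u v; rewrite !ord1.
have := tp 1%N _ _ r0 (incr 0) (incr n%:Z).
by rewrite /minor det_mx11 mxE (@toeplitz_nat _ _ n) ?subr0.
Qed.

Lemma totally_positive_upto1P :
  totally_positive_upto 1 (toeplitz f) <-> (forall n, 0 <= f n).
Proof.
split=> [|f0 k i j]; first exact: totally_positive_coef_ge0.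
rewrite -eqn_leq => /eqP k1; case: _ / k1 i j => i j _ _.
by rewrite /minor det_mx11 mxE toeplitz_ge0.
Qed.

Lemma minor2E (A : int -> int -> R) (i j : 'I_2 -> int) :
  minor A i j = A (i 0) (j 0) * A (i 1) (j 1) - A (i 0) (j 1) * A (i 1) (j 0).
Proof.
rewrite /minor (expand_det_row _ 0) !big_ord_recl big_ord0 addr0 /cofactor.
rewrite !det_mx11 !mxE /= expr0 expr1 mul1r mulN1r mulrN.
by congr (_ * A (i _) (j _) - A (i _) (j _) * A (i _) (j _)); apply/val_inj.
Qed.

(** In a minor on rows [i 0 < i 1] and columns [j 0 < j 1], the lower left entry has the smallest
    offset [t = j 0 - i 1]. The row gap [x] and the column gap [y] give the other three offsets
    [t + x], [t + y] and [t + x + y]. *)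
Lemma totally_positive_upto2P :
  totally_positive_upto 2 (toeplitz f) <->
  (forall n, 0 <= f n) /\
  (forall t x y, f t * f (t + x + y)%N <= f (t + x)%N * f (t + y)%N).
Proof.
split=> [tp|[f0 fM] k i j /andP[k0 k2] incri incrj].
  (* A zero gap repeats a row or a column, so it gives no minor; the inequality is then an
     equality. *)
  have f0 := totally_positive_coef_ge0 (isT : (0 < 2)%N) tp; split=> // t [|x] [|y].
  - by rewrite !addn0.
  - by rewrite !addn0.
  - by rewrite !addn0 mulrC.
  have incr (a d : nat) :
      strictly_increasing (fun u : 'I_2 => (a + u * d.+1)%N%:Z).
    by move=> u v uv; rewrite ltz_nat ltn_add2l ltn_pmul2r.
  (* Rows [0] and [x.+1]; the first column [t + x.+1] is chosen to leave offset [t] in the lower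
     left corner. *)
  have := tp 2%N _ _ isT (incr 0%N x) (incr (t + x.+1)%N y).
  rewrite minor2E /= (@toeplitz_nat _ _ (t + x.+1)%N); last by lia.
  rewrite (@toeplitz_nat _ _ (t + y.+1)%N); last by lia.
  rewrite (@toeplitz_nat _ _ (t + x.+1 + y.+1)%N); last by lia.
  rewrite (@toeplitz_nat _ _ t); last by lia.
  by rewrite subr_ge0 mulrC.
have /orP[/eqP k1|/eqP k1] : (k == 1%N) || (k == 2%N) by lia.
  by subst k; rewrite /minor det_mx11 mxE toeplitz_ge0.
subst k; rewrite minor2E subr_ge0.
have i01 := incri 0 1 isT; have j01 := incrj 0 1 isT.
(* For a negative offset the lower left entry is zero, and the minor is the product of its diagonal
   entries. *)
have [ji|ij] := ltP (j 0) (i 1).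
  by rewrite (toeplitz_lt ji) mulr0 mulr_ge0 ?toeplitz_ge0.
pose t := `|(j 0 - i 1)%R|%N; pose x := `|(i 1 - i 0)%R|%N.
pose y := `|(j 1 - j 0)%R|%N.
rewrite (@toeplitz_nat (i 0) (j 1) (t + x + y)%N); last by lia.
rewrite (@toeplitz_nat (i 1) (j 0) t); last by lia.
rewrite (@toeplitz_nat (i 0) (j 0) (t + x)%N); last by lia.
rewrite (@toeplitz_nat (i 1) (j 1) (t + y)%N); last by lia.
by rewrite mulrC fM.
Qed.

End Toeplitz.

Lemma eq_fps_inv (R : realType) (f g : fps R) :
  f =1 g -> fps_inv f =1 fps_inv g.
Proof.
move=> fg n; elim/ltn_ind: n => -[|n] IH; first by rewrite /fps_inv /= fg.
rewrite !fps_invS fg; congr (_ * _); apply: eq_bigr => k _.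
by rewrite fg IH // ltnS leq_subr.
Qed.

Lemma fps_inv_subN0 (R : realType) (f : fps R) :
  f 0%N = 1 -> fps_inv (fps_subN f) 0%N = 1.
Proof. by move=> f0; rewrite /fps_inv /= /fps_subN f0 mulr1 expr0 invr1. Qed.

(** Compare coefficients in [f(-z) g(z) = 1]: the sign of the recursion for an inverse absorbs one
    factor of [(-1) ^+ k.+1]. *)
Lemma fps_inv_subNS (R : realType) (f : fps R) n :
  f 0%N = 1 -> fps_inv (fps_subN f) n.+1 =
    \sum_(k < n.+1) (-1) ^+ k * f k.+1 * fps_inv (fps_subN f) (n - k)%N.
Proof.
move=> f0; rewrite fps_invS {1}/fps_subN f0 mulr1 expr0 invr1 mulN1r -sumrN.
by apply: eq_bigr => k _; rewrite /fps_subN exprS mulN1r !mulNr opprK.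
Qed.

(** The explicit list lets coefficients be evaluated by computation. *)
Lemma cubic_coefs (R : realType) :
  [/\ fps_of_poly (1 + 4 *: 'X + 3 *: 'X^2 + 'X^3)
        =1 (fun n => [:: 1; 4; 3; 1]`_n : R) &
      fps_subN (fps_of_poly (1 + 4 *: 'X + 3 *: 'X^2 + 'X^3))
        =1 fps_of_poly (1 - 4 *: 'X + 3 *: 'X^2 - 'X^3 : {poly R})].
Proof.
by split=> -[|[|[|[|n]]]]; rewrite /fps_subN /fps_of_poly !coefE /=
  ?nth_nil; ring.
Qed.

Lemma quadratic_coefs (R : realType) :
  [/\ fps_of_poly (1 + 'X + 2 *: 'X^2) =1 (fun n => [:: 1; 1; 2]`_n : R) &
      fps_subN (fps_of_poly (1 + 'X + 2 *: 'X^2))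
        =1 fps_of_poly (1 - 'X + 2 *: 'X^2 : {poly R})].
Proof.
by split=> -[|[|[|n]]]; rewrite /fps_subN /fps_of_poly !coefE /= ?nth_nil;
  ring.
Qed.

Theorem mainTheorem3 (R : realType) :
  [/\ ~ (forall f g : fps R,
           f 0%N = 1 -> g 0%N = 1 -> g =1 fps_inv (fps_subN f) ->
           forall r : nat, (0 < r)%N ->
             (totally_positive_upto r (toeplitz f) <->
              totally_positive_upto r (toeplitz g))),
      (let f : fps R := fps_of_poly (1 + 4 *: 'X + 3 *: 'X^2 + 'X^3) in
       let g : fps R := fps_inv (fps_subN f) in
       [/\ g =1 fps_inv (fps_of_poly (1 - 4 *: 'X + 3 *: 'X^2 - 'X^3)),
           totally_positive_upto 2 (toeplitz f) &
           ~ totally_positive_upto 2 (toeplitz g)]) &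
      (let f : fps R := fps_of_poly (1 + 'X + 2 *: 'X^2) in
       let g : fps R := fps_inv (fps_subN f) in
       [/\ g =1 fps_inv (fps_of_poly (1 - 'X + 2 *: 'X^2)),
           totally_positive_upto 1 (toeplitz f) &
           ~ totally_positive_upto 1 (toeplitz g)])].
Proof.
have [f2E f2N] := cubic_coefs R; have [f1E f1N] := quadratic_coefs R.
set f2 := fps_of_poly (1 + 4 *: 'X + _ + _) in f2E f2N *.
set f1 := fps_of_poly (1 + 'X + _) in f1E f1N *.
have g1E : fps_inv (fps_subN f1) =1 fps_inv _ := eq_fps_inv f1N.
have g2E : fps_inv (fps_subN f2) =1 fps_inv _ := eq_fps_inv f2N.
have f1tp : totally_positive_upto 1 (toeplitz f1).
  apply/totally_positive_upto1P => -[|[|[|n]]]; rewrite f1E //= ?nth_nil //; lra.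
have f10 : f1 0%N = 1 by rewrite f1E.
have f20 : f2 0%N = 1 by rewrite f2E.
have g1ntp : ~ totally_positive_upto 1 (toeplitz (fps_inv (fps_subN f1))).
  set g := fps_inv (fps_subN f1).
  have g0 : g 0%N = 1 := fps_inv_subN0 f10.
  have gS n : g n.+1 = \sum_(k < n.+1) (-1) ^+ k * f1 k.+1 * g (n - k)%N :=
    fps_inv_subNS n f10.
  have g1 : g 1%N = 1 by rewrite gS !big_ord_recl big_ord0 !f1E /= g0; ring.
  have g2 : g 2%N = -1 by rewrite gS !big_ord_recl big_ord0 !f1E /= g0 g1; ring.
  by move/totally_positive_upto1P/(_ 2%N); rewrite g2; lra.
split=> /=.
(* The quadratic example with [r = 1] already refutes the general equivalence. *)
- move=> H; apply: g1ntp; apply/(H f1) => //; exact: fps_inv_subN0.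
- split=> //.
    apply/totally_positive_upto2P; split=> [n|t x y].
      by rewrite f2E; case: n => [|[|[|[|n]]]]; rewrite /= ?nth_nil; lra.
    rewrite !f2E.
    (* Coefficients vanish from index 4 on, so splitting each index into [0], [1], [2], [3] and the
       rest leaves only numerical inequalities. *)
    case: t => [|[|[|[|t]]]]; case: x => [|[|[|[|x]]]]; case: y => [|[|[|[|y]]]];
      rewrite ?addn0 ?addnS ?addSn /= ?nth_nil; lra.
  (* This instance reads [g 3 * g 5 <= g 4 * g 4]. *)
  move/totally_positive_upto2P => [_ /(_ 3%N 1%N 1%N)].
  set g := fps_inv (fps_subN f2).
  have g0 : g 0%N = 1 := fps_inv_subN0 f20.
  have gS n : g n.+1 = \sum_(k < n.+1) (-1) ^+ k * f2 k.+1 * g (n - k)%N :=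
    fps_inv_subNS n f20.
  have g1 : g 1%N = 4 by rewrite gS !big_ord_recl big_ord0 !f2E /= g0; ring.
  have g2 : g 2%N = 13.
    by rewrite gS !big_ord_recl big_ord0 !f2E /= g0 g1; ring.
  have g3 : g 3%N = 41.
    by rewrite gS !big_ord_recl big_ord0 !f2E /= g0 g1 g2; ring.
  (* From here on only the three preceding values matter:
     [g n.+3 = 4 * g n.+2 - 3 * g n.+1 + g n]. *)
  have g4 : g 4%N = 129.
    by rewrite gS !big_ord_recl big_ord0 !f2E /= g1 g2 g3; ring.
  have g5 : g 5%N = 406.
    by rewrite gS !big_ord_recl big_ord0 !f2E /= g2 g3 g4; ring.
  rewrite g3 g4 g5; lra.
- by split.
Qed.
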